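(* Let $G=(V,E)$ be a finite graph (multiple edges and loops allowed) and let $e\in E$ be an edge which is not a loop. Then \[ \theta_G(\beta,\xi)=(1-\beta)\,\theta_{G\setminus e}(\beta,\xi)+\beta\,\theta_{G/e}(\beta,\xi). \]
   Context: The polynomials $f_n$ are defined by $f_0(x)=1$, $f_1(x)=0$, $f_{n+1}(x)=xf_n(x)+f_{n-1}(x)$. For a finite graph $G=(V,E)$, $\theta_G(\beta,\xi)=\sum_{s\subset E}\beta^{|s|}\prod_{i\in V}f_{d_i(s)}(\xi-\xi^{-1})$, where $d_i(s)$ is the degree of node $i$ in the subgraph with edge set $s$ (a loop at $i$ contributes $2$). $G\setminus e$ is the graph obtained by deleting $e$, and $G/e$ is the graph obtained by contracting $e$ (identifying its two endpoints and removing $e$; other edges are kept, possibly becoming multiple edges or loops). A loop is an edge whose two ends are the same node. *)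

(* Defs.v *)
From HB Require Import structures.
From mathcomp Require Import all_boot all_order all_algebra.
Set Implicit Arguments. Unset Strict Implicit. Unset Printing Implicit Defensive.
Import GRing.Theory.
Local Open Scope ring_scope.

(* Finite multigraphs: parallel edges are distinct elements of [edge], and
   the two ends of an edge are listed in an arbitrary order. *)
Record multigraph := Multigraph {
  vertex : finType;
  edge : finType;
  ends : edge -> vertex * vertex }.

Definition is_loop (G : multigraph) (e : edge G) : bool :=
  (ends e).1 == (ends e).2.

(* A loop at [i] is counted twice. *)
Definition degree (G : multigraph) (s : {set edge G}) (i : vertex G) : nat :=
  (\sum_(e in s) ((i == (ends e).1) + (i == (ends e).2)))%N.

Definition delete_edge (G : multigraph) (e : edge G) : multigraph :=
  @Multigraph (vertex G) {e' : edge G | e' != e}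
    (fun e' => ends (val e')).

(* The quotient map identifying the two ends of [e]: the merged node is
   represented by the first end. *)
Definition merge_ends (G : multigraph) (e : edge G) (i : vertex G) : vertex G :=
  if i == (ends e).2 then (ends e).1 else i.

Definition merged_vertex (G : multigraph) (e : edge G) : finType :=
  {i : vertex G | i \in codom (merge_ends e)}.

Definition to_merged (G : multigraph) (e : edge G) (i : vertex G) :
    merged_vertex e :=
  exist _ (merge_ends e i) (codom_f (merge_ends e) i).

Definition contract_edge (G : multigraph) (e : edge G) : multigraph :=
  @Multigraph (merged_vertex e) {e' : edge G | e' != e}
    (fun e' => (to_merged e (ends (val e')).1, to_merged e (ends (val e')).2)).

Fixpoint fpoly (R : comUnitRingType) (n : nat) : {poly R} :=
  match n with
  | 0 => 1
  | n'.+1 => match n' with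
             | 0 => 0
             | n''.+1 => 'X * fpoly R n' + fpoly R n''
             end
  end.

Definition theta (R : comUnitRingType) (G : multigraph) (beta xi : R) : R :=
  \sum_(s : {set edge G})
    beta ^+ #|s| * \prod_(i : vertex G) (fpoly R (degree s i)).[xi - xi^-1].

(* Main.v *)
Require Import Defs.
From HB Require Import structures.
From mathcomp Require Import all_boot all_order all_algebra.
From mathcomp Require Import ring.
Import GRing.Theory.
Local Open Scope ring_scope.

(** Pair each edge set [s] avoiding [e] with [e |: s].  If [n] and [m] are the
degrees in [s] of the two ends of [e], the two terms of [theta G] share all
factors except [f_n f_m + beta f_{n+1} f_{m+1}], and the addition formula
[f_{n+m} = f_{n+1} f_{m+1} + f_n f_m] rewrites this as
[(1 - beta) f_n f_m + beta f_{n+m}]. *)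

Lemma fpolySS (R : comUnitRingType) n :
  fpoly R n.+2 = 'X * fpoly R n.+1 + fpoly R n.
Proof. by []. Qed.

(** Induction on [n] for all [m]. The base case is [f_0 = 1], [f_1 = 0]. In the step one unit moves
    from [n] to [m], and the recurrence, applied to [f_{m+2}] and to [f_{n+2}], makes both sides
    agree. *)
Lemma fpolyD (R : comUnitRingType) n m :
  fpoly R (n + m) = fpoly R n.+1 * fpoly R m.+1 + fpoly R n * fpoly R m.
Proof.
elim: n m => [|n IHn] m; first by rewrite add0n /= mul0r mul1r add0r.
by rewrite addSnnS IHn !fpolySS; ring.
Qed.

Lemma notin_imset_val (T : finType) (x : T) (t : {set {y : T | y != x}}) :
  x \notin val @: t.
Proof. by apply/imsetP=> -[y _ xy]; have := valP y; rewrite /= -xy eqxx. Qed.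

(** The sets without [x] and the sets with [x] are each in bijection with the subsets of the
    subtype. The preimage under [val] inverts both bijections, since it ignores [x]. *)
Lemma sum_set_split_elt (R : nmodType) (T : finType) (x : T)
    (F : {set T} -> R) :
  \sum_(s : {set T}) F s =
  \sum_(t : {set {y : T | y != x}}) (F (val @: t) + F (x |: val @: t)).
Proof.
have vK (t : {set {y : T | y != x}}) : val @^-1: (val @: t) = t.
  by apply/setP=> y; rewrite inE mem_imset //; apply: val_inj.
have vKU (t : {set {y : T | y != x}}) : val @^-1: (x |: val @: t) = t.
  rewrite -[RHS]vK; apply/setP=> y; rewrite !inE.
  by rewrite (negbTE (valP y)).
have Kv (s : {set T}) : val @: [set y : {y : T | y != x} | val y \in s] = s :\ x.
  apply/setP=> y; rewrite !inE; apply/imsetP/andP => [[z]|[yx ys]].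
    by rewrite inE => zs ->; split=> //; apply: (valP z).
  by exists (exist _ y yx); rewrite ?inE.
rewrite (bigID (fun s : {set T} => x \in s)) /= addrC big_split /=; congr (_ + _).
- rewrite (reindex_onto (fun t : {set {y : T | y != x}} => val @: t)
             (fun s => val @^-1: s)) /=.
    by apply: eq_bigl => t; rewrite notin_imset_val vK eqxx.
  by move=> s xs; rewrite Kv; apply/setDidPl; rewrite disjoint_sym disjoints1.
rewrite (reindex_onto (fun t : {set {y : T | y != x}} => x |: val @: t)
           (fun s => val @^-1: s)) /=.
  by apply: eq_bigl => t; rewrite setU11 vKU eqxx.
by move=> s xs; rewrite Kv setD1K.
Qed.

Lemma degree_lift (G : multigraph) (e : edge G) (t : {set edge (delete_edge e)}) (i : vertex G) :
  degree (G := G) (val @: t) i = degree t i.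
Proof. by rewrite /degree big_imset //= => x y _ _; apply: val_inj. Qed.

Lemma degree_setU1 (G : multigraph) (e : edge G) (s : {set edge G}) (i : vertex G) : e \notin s ->
  degree (e |: s) i = ((i == (ends e).1) + (i == (ends e).2) + degree s i)%N.
Proof. by move=> es; rewrite /degree big_setU1. Qed.

Lemma codom_merge_ends (G : multigraph) (e : edge G) (i : vertex G) :
  ~~ is_loop e -> (i \in codom (merge_ends e)) = (i != (ends e).2).
Proof.
move=> he; apply/codomP/idP => [[j ->]|ib]; last first.
  by exists i; rewrite /merge_ends (negbTE ib).
by rewrite /merge_ends; case: ifP => [_|/negbT//].
Qed.

(** The merged node is represented by the first end of [e] and inherits the edge ends of both. The
    set [t] can be read in either graph because deletion and contraction have the same edge type. *)
Lemma degree_contract (G : multigraph) (e : edge G)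
    (t : {set edge (contract_edge e)})
    (i : vertex (contract_edge e)) : ~~ is_loop e ->
  degree t i = (degree (G := delete_edge e) t (val i)
    + (val i == (ends e).1) * degree (G := delete_edge e) t (ends e).2)%N.
Proof.
move=> he; have ib : val i != (ends e).2.
  by rewrite -codom_merge_ends //; apply: (valP i).
(* The claim for a single edge end at [j]. At most one summand is nonzero, because [val i] is never
   the second end of [e]. *)
have key (j : vertex G) :
    (i == to_merged e j) =
    ((val i == j) + (val i == (ends e).1) * ((ends e).2 == j))%N :> nat.
  rewrite -val_eqE /= /merge_ends [(ends e).2 == j]eq_sym.
  case: (eqVneq j (ends e).2) => [->|_].
    by rewrite (negbTE ib) muln1.
  by rewrite muln0 addn0.
rewrite /degree big_distrr -big_split; apply: eq_bigr => f _ /=.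
by rewrite !key mulnDr addnACA.
Qed.

(** The nodes of the contraction are exactly the nodes of [G] other than the second end of [e]. *)
Lemma prod_contract (R : comUnitRingType) (G : multigraph) (e : edge G)
    (F : vertex G -> R) : ~~ is_loop e ->
  \prod_(i : vertex (contract_edge e)) F (val i) =
  F (ends e).1 * \prod_(i | (i != (ends e).2) && (i != (ends e).1)) F i.
Proof.
move=> he; rewrite -(bigD1 (P := fun i => i != (ends e).2) (ends e).1) //.
rewrite -(eq_bigl _ _ (fun i => codom_merge_ends G e i he)).
by rewrite [RHS]big_sub.
Qed.

Theorem theorem7 (R : comUnitRingType) (G : multigraph) (e : edge G)
    (beta xi : R) (he : ~~ is_loop e) (hxi : xi \is a GRing.unit) :
  theta G beta xi =
    (1 - beta) * theta (delete_edge e) beta xi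
    + beta * theta (contract_edge e) beta xi.
Proof.
have ba : (ends e).2 != (ends e).1 by rewrite eq_sym.
(* All three sums now range over the same sets [t], so the identity can be proved term by term. *)
rewrite /theta (@sum_set_split_elt _ _ e) !big_distrr -big_split.
apply: eq_bigr => t _ /=.
set x := xi - xi^-1; set a := (ends e).1; set b := (ends e).2.
pose d (i : vertex G) := degree (G := delete_edge e) t i.
pose P := \prod_(i | (i != b) && (i != a)) (fpoly R (d i)).[x].
have prodE (F : vertex G -> R) :
    \prod_i F i = F b * (F a * \prod_(i | (i != b) && (i != a)) F i).
  by rewrite (bigD1 b) //= (bigD1 a) // eq_sym.
rewrite cardsU1 notin_imset_val card_imset; last exact: val_inj.
have -> : \prod_i (fpoly R (degree (G := G) (val @: t) i)).[x]
    = (fpoly R (d b)).[x] * ((fpoly R (d a)).[x] * P).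
  by rewrite prodE !degree_lift; do 2!congr (_ * _); apply: eq_bigr => i _;
    rewrite degree_lift.
(* As [a] and [b] are distinct, adding [e] raises the degree of each by exactly one and leaves [P]
   unchanged. *)
have -> : \prod_i (fpoly R (degree (G := G) (e |: val @: t) i)).[x]
    = (fpoly R (d b).+1).[x] * ((fpoly R (d a).+1).[x] * P).
  rewrite prodE !degree_setU1 ?notin_imset_val // !degree_lift !eqxx.
  rewrite (negbTE ba) [_ == b]eq_sym (negbTE ba); do 2!congr (_ * _).
  apply: eq_bigr => i /andP[/negbTE ib /negbTE ia].
  by rewrite degree_setU1 ?notin_imset_val // degree_lift ib ia.
have -> : \prod_i (fpoly R (degree (G := delete_edge e) t i)).[x]
    = (fpoly R (d b)).[x] * ((fpoly R (d a)).[x] * P) by rewrite prodE.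
have -> : \prod_i (fpoly R (degree (G := contract_edge e) t i)).[x]
    = (fpoly R (d a + d b)).[x] * P.
  under eq_bigr => i _ do rewrite degree_contract //.
  rewrite (prod_contract _ _ e
    (fun i => (fpoly R (d i + (i == a) * d b)).[x]) he) eqxx mul1n.
  congr (_ * _); apply: eq_bigr => i /andP[_ /negbTE ->].
  by rewrite mul0n addn0.
(* Every term has the factor [beta ^+ #|t| * P]; the extra [beta] from [exprS] is the weight of
   [e]. *)
rewrite fpolyD hornerD !hornerM exprS; ring.
Qed.
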